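(* Let $\Gamma_1$ be a lattice in $\mathbb{R}^d$, let $\Gamma_2$ be a sublattice of $\Gamma_1$ of index $m$, and write $\Gamma_1=\bigcup_{i=1}^m (c_i+\Gamma_2)$ as a disjoint union of cosets with $c_1=0$, where the points of the coset $c_i+\Gamma_2$ are said to have colour $c_i$. Let $R\in OC(\Gamma_1)$ and let $\Sigma_i(R)$ be the coincidence index of $R$ with respect to $\Gamma_i$, for $i=1,2$. Define: - $s$ is the number of colours in the colouring of $\Gamma_1(R^{-1})$ determined by $\Gamma_2$, i.e. the number of cosets $c_i+\Gamma_2$ with $(c_i+\Gamma_2)\cap\Gamma_1(R^{-1})\neq\emptyset$; - $t$ is the number of colours in the colouring of $\Gamma_1(R)$ determined by $\Gamma_2$, i.e. the number of cosets $c_j+\Gamma_2$ with $(c_j+\Gamma_2)\cap\Gamma_1(R)\neq\emptyset$; - $u$ is the number of colours $c_i$ such that some point of $\Gamma_1(R^{-1})$ coloured $c_i$ is mapped by $R$ to a point coloured $c_1$ in the colouring of $\Gamma_1(R)$, i.e. the number of cosets $c_i+\Gamma_2$ with $R[(c_i+\Gamma_2)\cap\Gamma_1(R^{-1})]\cap\Gamma_2\neq\emptyset$; - $v$ is the number of colours in the colouring of $\Gamma_1(R)$ that are intersected by the images under $R$ of the points of $\Gamma_1(R^{-1})$ coloured $c_1$, i.e. the number of cosets $c_j+\Gamma_2$ with $(c_j+\Gamma_2)\cap R[\Gamma_2\cap\Gamma_1(R^{-1})]\neq\emptyset$. Then $$\Sigma_2(R)=\frac{t\cdot u\cdot\Sigma_1(R)}{m}=\frac{s\cdot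 v\cdot\Sigma_1(R)}{m}.$$ Moreover, $s\mid m$, $t\mid m$, $u\mid s$, and $v\mid t$.
   Context: A lattice $\Gamma$ in $\mathbb{R}^d$ is the $\mathbb{Z}$-span of $d$ vectors that are linearly independent over $\mathbb{R}$. A sublattice of $\Gamma$ is a subgroup of $\Gamma$ of finite index. For $R\in O(d)$ put $\Gamma(R):=\Gamma\cap R\Gamma$ (so $\Gamma(R^{-1})=\Gamma\cap R^{-1}\Gamma$). An $R\in O(d)$ is a coincidence isometry of $\Gamma$ if $\Gamma(R)$ is a sublattice of $\Gamma$ (i.e. has finite index in $\Gamma$); in that case the coincidence index of $R$ with respect to $\Gamma$ is $\Sigma(R):=[\Gamma:\Gamma(R)]=[R\Gamma:\Gamma(R)]$. The set of coincidence isometries of $\Gamma$ is a group, denoted $OC(\Gamma)$. If $\Gamma_2$ is a sublattice of $\Gamma_1$, then $OC(\Gamma_1)=OC(\Gamma_2)$ (known fact), so both coincidence indices $\Sigma_1(R)=[\Gamma_1:\Gamma_1(R)]$ and $\Sigma_2(R)=[\Gamma_2:\Gamma_2(R)]$ are defined for $R\in OC(\Gamma_1)$. Note that $R[\Gamma_1(R^{-1})]=\Gamma_1(R)$. The colourings of $\Gamma_1(R^{-1})$ and $\Gamma_1(R)$ determined by $\Gamma_2$ are those in which each point inherits its colour from $\Gamma_1$. *)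

(* Defs.v *)
From mathcomp Require Import all_boot all_order all_algebra finmap.
From mathcomp Require Import boolp classical_sets functions cardinality reals.

Set Implicit Arguments.
Unset Strict Implicit.
Unset Printing Implicit Defensive.

Import Order.TTheory GRing.Theory Num.Theory.

Local Open Scope classical_set_scope.
Local Open Scope ring_scope.

Definition is_lattice (R : realType) (d : nat) (G : set 'cV[R]_d) : Prop :=
  exists b : d.-tuple 'cV[R]_d,
    free b /\ G = [set \sum_(i < d) tnth b i *~ z i | z in [set: 'I_d -> int]].

Definition add_coset (V : zmodType) (a : V) (H : set V) : set V :=
  [set a + x | x in H].

Definition add_cosets (V : zmodType) (G H : set V) : set (set V) :=
  [set add_coset a H | a in G].

(* The index [G : H]; it takes the junk value 0 when the index is infinite,
   since fset_set sends infinite sets to the empty fset. *)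
Definition subgroup_index (V : zmodType) (G H : set V) : nat :=
  #|` fset_set (add_cosets G H)|.

Definition is_sublattice (V : zmodType) (H G : set V) : Prop :=
  [/\ H `<=` G, zmod_closed [in H] & finite_set (add_cosets G H)].

Definition orthogonal_mx (R : realType) (d : nat) (Q : 'M[R]_d) : Prop :=
  Q^T *m Q = 1%:M.

Definition image_mx (R : realType) (d : nat) (Q : 'M[R]_d) (G : set 'cV[R]_d) :
    set 'cV[R]_d :=
  [set Q *m x | x in G].

(* The coincidence site (sub)lattice G(Q), the intersection of G and QG. *)
Definition csl (R : realType) (d : nat) (G : set 'cV[R]_d) (Q : 'M[R]_d) :
    set 'cV[R]_d :=
  G `&` image_mx Q G.

Definition OC (R : realType) (d : nat) (G : set 'cV[R]_d) : set 'M[R]_d :=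
  [set Q | orthogonal_mx Q /\ is_sublattice (csl G Q) G].

Definition coincidence_index (R : realType) (d : nat) (G : set 'cV[R]_d)
    (Q : 'M[R]_d) : nat :=
  subgroup_index G (csl G Q).

(* The colours, i.e. the indices i of the cosets c_i + H, that occur in A. As the
   cosets c_i + H are pairwise distinct, counting indices is counting cosets. *)
Definition colours (V : zmodType) (m : nat) (c : 'I_m -> V) (H A : set V) :
    pred 'I_m :=
  [pred i | `[< add_coset (c i) H `&` A !=set0 >]].

(* Main.v *)
Require Import Defs.
From mathcomp Require Import all_boot all_order all_algebra finmap.
From mathcomp Require Import boolp classical_sets functions cardinality reals.

(* The number of colours occurring in a subgroup A of G1 is the index
   [A : A `&` G2], so each of s, t, u, v is an index of subgroups; applying the
   injective map Q to those defining s and u, the four become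
     t = [K : G2 `&` QG1],            u = [G2 `&` QG1 : G2 `&` QG2],
     s = [K : G1 `&` QG2],            v = [G1 `&` QG2 : G2 `&` QG2],
   where K = G1 `&` QG1. The two towers between K and G2 `&` QG2 give t u = s v,
   and comparing the towers from G1 down to G2 `&` QG2 through K and through G2
   gives Sigma1 t u = m Sigma2. *)

Set Implicit Arguments.
Unset Strict Implicit.
Unset Printing Implicit Defensive.

Import Order.TTheory GRing.Theory Num.Theory.

Local Open Scope classical_set_scope.
Local Open Scope ring_scope.

(** * Indices of subgroups in an abelian group, and colour counts as indices *)

Section Index.

Variable V : zmodType.
Implicit Types (G H K A B : set V) (x y z : V) (n : nat).

Definition subgroup H : Prop := zmod_closed [in H].

Lemma subgroupP H :
  subgroup H <-> H 0 /\ forall x y, H x -> H y -> H (x - y).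
Proof.
split=> -[H0 HB]; split.
- exact: set_mem H0.
- by move=> x y Hx Hy; apply: set_mem; apply: HB; apply: mem_set.
- exact: mem_set.
- by move=> x y /set_mem Hx /set_mem Hy; apply: mem_set; apply: HB.
Qed.

Lemma subgroup0 H : subgroup H -> H 0.
Proof. by case/subgroupP. Qed.

Lemma subgroupB H x y : subgroup H -> H x -> H y -> H (x - y).
Proof. by case/subgroupP=> _; apply. Qed.

Lemma subgroupN H x : subgroup H -> H x -> H (- x).
Proof.
by move=> sH Hx; rewrite -sub0r; apply: subgroupB => //; apply: subgroup0.
Qed.

Lemma subgroupD H x y : subgroup H -> H x -> H y -> H (x + y).
Proof.
by move=> sH Hx Hy; rewrite -[y]opprK; apply: subgroupB (subgroupN sH Hy).
Qed.

Lemma subgroup_subC H x y : subgroup H -> H (x - y) -> H (y - x).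
Proof. by move=> sH Hxy; rewrite -opprB; apply: subgroupN. Qed.

Lemma subgroup_sub_trans H x y z :
  subgroup H -> H (x - y) -> H (y - z) -> H (x - z).
Proof. by move=> sH Hxy Hyz; rewrite -(subrKA y); apply: subgroupD. Qed.

Lemma subgroup_setI G H : subgroup G -> subgroup H -> subgroup (G `&` H).
Proof.
move=> sG sH; apply/subgroupP; split; first by split; apply: subgroup0.
by move=> x y [? ?] [? ?]; split; apply: subgroupB.
Qed.

(** The Minkowski sum [A + B], with the summand from [B] recovered as [x - a]. *)
Definition subset_sum A B : set V := [set x | exists2 a, A a & B (x - a)].

Lemma subgroup_sum A B : subgroup A -> subgroup B -> subgroup (subset_sum A B).
Proof.
move=> sA sB; apply/subgroupP; split.
  by exists 0; rewrite ?subr0; apply: subgroup0.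
move=> x y [a Aa Bxa] [b Ab Byb]; exists (a - b); first exact: subgroupB.
have -> : x - y - (a - b) = (x - a) - (y - b) by rewrite !opprD addrACA.
exact: subgroupB.
Qed.

Lemma add_cosetE x H y : add_coset x H y <-> H (y - x).
Proof.
split=> [[h Hh <-]|Hyx]; first by rewrite addrC addKr.
by exists (y - x); rewrite // addrC subrK.
Qed.

Lemma add_coset_eq H x y : subgroup H ->
  add_coset x H = add_coset y H <-> H (x - y).
Proof.
move=> sH; split=> [eq_xy|Hxy].
  apply/add_cosetE; rewrite -eq_xy; apply/add_cosetE.
  by rewrite subrr; apply: subgroup0.
apply/seteqP; split=> z /add_cosetE Hz; apply/add_cosetE.
  exact: subgroup_sub_trans Hxy.
by apply: subgroup_sub_trans Hz _ => //; apply: subgroup_subC.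
Qed.

Definition transversal (I : Type) G H (f : I -> V) : Prop :=
  [/\ forall i, G (f i), forall x, G x -> exists i, H (x - f i)
    & forall i j, H (f i - f j) -> i = j].

(** Finiteness is part of the assertion, so the junk value 0 of [subgroup_index] cannot
    interfere. *)
Definition has_index G H n : Prop := exists f : 'I_n -> V, transversal G H f.

Lemma transversal_index (I : finType) G H (f : I -> V) :
  transversal G H f -> has_index G H #|I|.
Proof.
case=> Gf surf injf; exists (f \o enum_val); split=> [i|x /surf[i Hi]|i j].
- exact: Gf.
- by exists (enum_rank i); rewrite /= enum_rankK.
- by move/injf/enum_val_inj.
Qed.

(** The representatives list the cosets without repetition. As a by-product [n] is determined by [G]
    and [H], which is what allows two towers to be compared. *)
Lemma has_index_subgroup_index G H n :
  subgroup H -> has_index G H n -> subgroup_index G H = n.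
Proof.
move=> sH [f [Gf surf injf]].
have -> : subgroup_index G H =
    #|` fset_set [set add_coset (f i) H | i in [set: 'I_n]]|.
  congr #|` fset_set _|; apply/seteqP; split=> _ [x Gx <-]; last by exists (f x).
  have [i Hi] := surf x Gx; exists i => //.
  by apply/add_coset_eq => //; apply: subgroup_subC.
rewrite fset_set_image; last exact: finite_finset.
rewrite card_imfset /=; last by move=> i j /add_coset_eq -/(_ sH)/injf.
rewrite -[RHS](size_enum_ord n); apply/perm_size/uniq_perm;
  rewrite ?enum_uniq ?fset_uniq //.
move=> i; rewrite mem_enum in_fset_set; last exact: finite_finset.
by rewrite inE; apply: mem_set.
Qed.

Lemma finite_has_index G H : subgroup H -> finite_set (add_cosets G H) ->
  exists n, has_index G H n.
Proof.
move=> sH finGH; pose C := fset_set (add_cosets G H).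
have /choice[f fP] (X : C) : exists x, G x /\ add_coset x H = val X.
  by have := valP X; rewrite in_fset_set // => /set_mem[x]; exists x.
exists #|{: C}|; apply: (transversal_index (f := f)); split.
- by move=> X; case: (fP X).
- move=> x Gx; have CX : add_coset x H \in C.
    by rewrite in_fset_set //; apply: mem_set; exists x.
  by exists [` CX]%fset; apply/add_coset_eq => //; case: (fP [` CX]%fset).
- move=> X Y /(add_coset_eq _ _ sH).
  by case: (fP X) (fP Y) => _ -> [_ ->] /val_inj.
Qed.

Lemma has_index_mul G K H n p :
  subgroup G -> subgroup K -> K `<=` G -> H `<=` K ->
  has_index G K n -> has_index K H p -> has_index G H (n * p)%N.
Proof.
move=> sG sK KG HK [f [Gf surf injf]] [g [Kg surg injg]].
have -> : (n * p)%N = #|{: 'I_n * 'I_p}| by rewrite card_prod !card_ord.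
apply: (transversal_index (f := fun ij : 'I_n * 'I_p => f ij.1 + g ij.2)); split.
- by move=> [i j] /=; apply: subgroupD => //; apply: KG.
- move=> x Gx; have [i Ki] := surf x Gx; have [j Hj] := surg _ Ki.
  by exists (i, j); rewrite /= opprD addrA.
- move=> [i j] [i' j'] /= Hff.
  (* Both values of [g] lie in [K], so modulo [K] only [f i - f i'] survives. *)
  have eq_i : i = i'.
    apply: injf; have /(subgroupB sK)/(_ (subgroupB sK (Kg j) (Kg j'))) := HK _ Hff.
    by rewrite opprD addrACA addrK.
  by move: Hff; rewrite eq_i opprD addrACA subrr add0r => /injg ->.
Qed.

Lemma has_index_gt0 G H n : subgroup G -> has_index G H n -> (0 < n)%N.
Proof. by move=> /subgroup0 G0 [f [_ /(_ _ G0)[i _] _]]; case: n i {f} => [[]|]. Qed.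

(** Choose one point of [A] for each colour that occurs: two points of [A] have the same colour
    exactly when they differ by an element of [A] and [H]. *)
Lemma has_index_colours m (c : 'I_m -> V) G H A : subgroup H -> subgroup A ->
  A `<=` G -> transversal G H c -> has_index A (A `&` H) #|colours c H A|.
Proof.
move=> sH sA AG [Gc surc injc].
have /choice[f fP] (i : {i | colours c H A i}) : exists x, A x /\ H (x - c (val i)).
  by case: i => i /= /asboolP[x [/add_cosetE Hx Ax]]; exists x.
rewrite -card_sig; apply: (transversal_index (f := f)); split.
- by move=> i; case: (fP i).
- move=> x Ax; have [i Hi] := surc x (AG _ Ax).
  have Pi : colours c H A i by apply/asboolP; exists x; split=> //; apply/add_cosetE.
  have [Af Hf] := fP (exist _ i Pi); exists (exist _ i Pi).
  split; first exact: subgroupB.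
  by apply: subgroup_sub_trans Hi _ => //; apply: subgroup_subC.
- move=> i j [_ Hij]; have [[_ Hi] [_ Hj]] := (fP i, fP j).
  apply/val_inj/injc; apply: (subgroup_sub_trans _ (subgroup_subC sH Hi)) => //.
  exact: subgroup_sub_trans Hj.
Qed.

(** Read a transversal of [G] modulo [H] as a colouring and count the colours in [K]. *)
Lemma has_index_bottom G K H n :
  subgroup K -> subgroup H -> H `<=` K -> K `<=` G ->
  has_index G H n -> exists p, has_index K H p.
Proof.
move=> sK sH HK KG [f /(has_index_colours sH sK KG)].
by rewrite (setIidr HK); exists #|colours f H K|.
Qed.

(** The [f i] still meet every coset of [K], possibly with repetitions, so they only give
    finiteness. *)
Lemma has_index_top G K H n : subgroup K -> H `<=` K ->
  has_index G H n -> exists p, has_index G K p.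
Proof.
move=> sK HK [f [Gf surf _]]; apply: finite_has_index => //.
apply: (@sub_finite_set _ _ [set add_coset (f i) K | i in [set: 'I_n]]); last first.
  by apply: finite_image; exact: finite_finset.
move=> _ [x Gx <-]; have [i /HK Ki] := surf x Gx.
by exists i => //; apply/add_coset_eq => //; apply: subgroup_subC.
Qed.

Lemma has_index_dvd G K H n p : subgroup G -> subgroup K -> subgroup H ->
  K `<=` G -> H `<=` K -> has_index G H n -> has_index K H p -> (p %| n)%N.
Proof.
move=> sG sK sH KG HK iGH iKH; have [q iGK] := has_index_top sK HK iGH.
rewrite -(has_index_subgroup_index sH iGH).
have iGH' := has_index_mul sG sK KG HK iGK iKH.
by rewrite (has_index_subgroup_index sH iGH') dvdn_mull.
Qed.

(* Second isomorphism theorem: [A : A `&` H] = [A + (B `&` H) : B `&` H], and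
   A + (B `&` H) lies between B `&` H and B. *)
Lemma has_index_setI_dvd A B H n p : subgroup A -> subgroup B -> subgroup H ->
  A `<=` B -> has_index A (A `&` H) n -> has_index B (B `&` H) p -> (n %| p)%N.
Proof.
move=> sA sB sH AB [f [Af surf injf]] iB.
have sBH := subgroup_setI sB sH.
apply: (has_index_dvd sB (subgroup_sum sA sBH) sBH _ _ iB).
- by move=> x [a /AB Ba [Bxa _]]; rewrite -(subrK a x); apply: subgroupD.
- by move=> x BHx; exists 0; rewrite ?subr0 //; apply: subgroup0.
exists f; split=> [i|x [a Aa BHxa]|i j [_ Hij]].
- by exists (f i); rewrite // subrr; apply: subgroup0.
- have [i [Ai Hi]] := surf a Aa; exists i.
  by apply: subgroup_sub_trans BHxa _ => //; split=> //; apply: AB.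
- by apply: injf; split=> //; apply: subgroupB.
Qed.

(** All four divisibility claims of the theorem are instances of this. *)
Lemma colours_dvd m (c : 'I_m -> V) G H A B :
  subgroup H -> subgroup A -> subgroup B ->
  A `<=` B -> B `<=` G -> transversal G H c ->
  (#|colours c H A| %| #|colours c H B|)%N.
Proof.
move=> sH sA sB AB BG tc; apply: (has_index_setI_dvd sA sB sH AB).
  by apply: has_index_colours tc => //; apply: subset_trans BG.
exact: has_index_colours tc.
Qed.

End Index.

(** * Transport of subgroups and indices by an invertible matrix *)

Section Isometry.

Variables (R : realType) (d : nat).
Implicit Types (A B G H : set 'cV[R]_d) (Q : 'M[R]_d).

Lemma lattice_subgroup G : is_lattice G -> subgroup G.
Proof.
case=> b [_ ->]; apply/subgroupP; split.
  by exists (fun=> 0) => //; rewrite big1.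
move=> _ _ [z _ <-] [w _ <-]; exists (fun i => z i - w i) => //.
by rewrite -sumrB; apply: eq_bigr => i _; rewrite mulrzBr.
Qed.

Lemma subgroup_image_mx Q G : subgroup G -> subgroup (image_mx Q G).
Proof.
move=> sG; apply/subgroupP; split.
  by exists 0; rewrite ?mulmx0 //; apply: subgroup0.
move=> _ _ [x Gx <-] [y Gy <-]; exists (x - y); rewrite ?mulmxBr //.
exact: subgroupB.
Qed.

Lemma image_mx_inj Q : Q \in unitmx -> injective (mulmx Q : 'cV_d -> 'cV_d).
Proof. by move=> uQ; apply: can_inj (mulKmx uQ). Qed.

Lemma has_index_image_mx Q G H n : Q \in unitmx ->
  has_index G H n -> has_index (image_mx Q G) (image_mx Q H) n.
Proof.
move=> uQ [f [Gf surf injf]]; exists (fun i => Q *m f i); split.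
- by move=> i; exists (f i).
- move=> _ [x Gx <-]; have [i Hi] := surf x Gx.
  by exists i; exists (x - f i); rewrite ?mulmxBr.
- move=> i j [x Hx]; rewrite -mulmxBr => /(image_mx_inj uQ) eq_x.
  by apply: injf; rewrite -eq_x.
Qed.

Lemma image_mx_setI Q A B : Q \in unitmx ->
  image_mx Q (A `&` image_mx (invmx Q) B) = B `&` image_mx Q A.
Proof.
move=> uQ; apply/seteqP; split.
  move=> _ [x [Ax [y By eq_x]] <-]; split; last by exists x.
  by rewrite -eq_x mulKVmx.
move=> y [By [x Ax eq_y]]; exists x => //; split=> //.
by exists y; rewrite // -eq_y mulKmx.
Qed.

End Isometry.

Theorem theorem2p2 (R : realType) (d : nat) (G1 G2 : set 'cV[R]_d) (m : nat)
    (c : 'I_m -> 'cV[R]_d) (Q : 'M[R]_d)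
    (hG1 : is_lattice G1)
    (hG2 : is_sublattice G2 G1)
    (hm : subgroup_index G1 G2 = m)
    (hc : G1 = \bigcup_i add_coset (c i) G2)
    (hdisj : trivIset [set: 'I_m] (fun i => add_coset (c i) G2))
    (hc1 : forall i : 'I_m, i = 0%N :> nat -> c i = 0)
    (hQ : OC G1 Q) :
  let Sigma1 := coincidence_index G1 Q in
  let Sigma2 := coincidence_index G2 Q in
  let s := #|colours c G2 (csl G1 (invmx Q))| in
  let t := #|colours c G2 (csl G1 Q)| in
  let u := #|[pred i : 'I_m |
    `[< image_mx Q (add_coset (c i) G2 `&` csl G1 (invmx Q)) `&` G2 !=set0 >]]| in
  let v := #|colours c G2 (image_mx Q (G2 `&` csl G1 (invmx Q)))| in
  [/\ Sigma2%:R = (t * u * Sigma1)%:R / m%:R :> rat,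
      Sigma2%:R = (s * v * Sigma1)%:R / m%:R :> rat &
      [/\ (s %| m)%N, (t %| m)%N, (u %| s)%N & (v %| t)%N]].
Proof.
move=> Sigma1 Sigma2 s t u v.
have [G21 sG2 _] := hG2; have sG1 := lattice_subgroup hG1.
have [orthQ [_ sK finK]] := hQ.
have uQ : Q \in unitmx by have [] := mulmx1_unit orthQ.
have G1P x : G1 x <-> exists i, G2 (x - c i).
  rewrite hc; split=> [[i _ /add_cosetE ?]|[i ?]]; first by exists i.
  by exists i => //; apply/add_cosetE.
have tc : transversal G1 G2 c.
  split=> [i|x /G1P //|i j G2ij].
    by apply/G1P; exists i; rewrite subrr; apply: subgroup0.
  apply: hdisj => //; exists (c i); split; apply/add_cosetE => //.
  by rewrite subrr; apply: subgroup0.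
have iG12 : has_index G1 G2 m by exists c.
(* [Q] carries [K'] onto [csl G1 Q], [M] onto [G2] intersected with [Q G1], and the part of [K'] in
   [G2] onto [K2]. *)
pose K' := csl G1 (invmx Q); pose M := G1 `&` image_mx (invmx Q) G2.
pose K2 := G1 `&` image_mx Q G2.
have sQ H P : subgroup H -> subgroup (image_mx P H) by exact: subgroup_image_mx.
have sK' : subgroup K' by apply: subgroup_setI => //; apply: sQ.
have sM : subgroup M by apply: subgroup_setI => //; apply: sQ.
have sK2 : subgroup K2 by apply: subgroup_setI => //; apply: sQ.
have sL : subgroup (csl G2 Q) by apply: subgroup_setI => //; apply: sQ.
have imS P : image_mx P G2 `<=` image_mx P G1 by apply: image_subset.
have KG1 : csl G1 Q `<=` G1 by apply: subIsetl.
have K'G1 : K' `<=` G1 by apply: subIsetl.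
have MK' : M `<=` K' by apply: setIS.
have K2K : K2 `<=` csl G1 Q by apply: setIS.
have LK2 : csl G2 Q `<=` K2 by apply: setSI.
have G2I A : (G1 `&` A) `&` G2 = G2 `&` A.
  by rewrite setIAC (setIidr G21).
(* A point of [G1] mapped by [Q] into [G2] lies in [K'] automatically, because [G2] is contained in
   [G1]; such points form [M]. *)
have uE : u = #|colours c G2 M|.
  apply: eq_card => i; apply/asboolP/asboolP.
    move=> [_ [[x [cx [G1x _]] <-] G2Qx]]; exists x; split=> //; split=> //.
    by exists (Q *m x); rewrite ?mulKmx.
  move=> [y [cy [G1y [x G2x eq_y]]]].
  have Qy : Q *m y = x by rewrite -eq_y mulKVmx.
  exists x; split=> //; exists y => //; split=> //; split=> //.
  by exists x => //; apply: G21.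
have vE : v = #|colours c G2 K2|.
  congr #|colours _ _ _|; rewrite setIA (setIidl G21).
  exact: image_mx_setI.
(* Count colours on the side of [invmx Q], then push the index forward by [Q]; the same is done for
   [u]. *)
have iS : has_index (csl G1 Q) K2 s.
  have := has_index_image_mx uQ (has_index_colours sG2 sK' K'G1 tc).
  by rewrite G2I !image_mx_setI.
have iT : has_index (csl G1 Q) (G2 `&` image_mx Q G1) t.
  by have := has_index_colours sG2 sK KG1 tc; rewrite G2I.
have iU : has_index (G2 `&` image_mx Q G1) (csl G2 Q) u.
  have MG1 := subset_trans MK' K'G1.
  rewrite uE; have := has_index_image_mx uQ (has_index_colours sG2 sM MG1 tc).
  by rewrite G2I !image_mx_setI.
have iV : has_index K2 (csl G2 Q) v.
  have K2G1 := subset_trans K2K KG1.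
  by rewrite vE; have := has_index_colours sG2 sK2 K2G1 tc; rewrite G2I.
have [n iK] := finite_has_index sK finK.
have S1n : Sigma1 = n by apply: has_index_subgroup_index.
have iLsv := has_index_mul sG1 sK KG1 (subset_trans LK2 K2K) iK
  (has_index_mul sK sK2 K2K LK2 iS iV).
have iLtu : has_index G1 (csl G2 Q) (n * (t * u))%N.
  apply: (has_index_mul sG1 sK KG1 (subset_trans LK2 K2K) iK).
  apply: has_index_mul iT iU => //; first by apply: subgroup_setI => //; apply: sQ.
    exact: setSI.
  exact: setIS.
have LG2 : csl G2 Q `<=` G2 by apply: subIsetl.
(* The hypothesis on [Q] concerns [G1] only; finiteness of the index of [csl G2 Q] in [G2] comes
   from its finite index in [G1]. *)
have [q iq] := has_index_bottom sG2 sL LG2 G21 iLsv.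
have S2q : Sigma2 = q by apply: has_index_subgroup_index.
have iLm := has_index_mul sG1 sG2 G21 LG2 iG12 iq.
have idx := has_index_subgroup_index sL.
have m_gt0 := has_index_gt0 sG1 iG12.
(* Rational division by zero returns 0, so [m] must be positive before denominators are cleared. *)
have m_neq0 : m%:R != 0 :> rat by rewrite pnatr_eq0 -lt0n.
(* Every colour occurs in [G1], so divisors of [m] also come from [colours_dvd]. *)
have colm : #|colours c G2 G1| = m.
  rewrite -[RHS](has_index_subgroup_index sG2 iG12).
  have := has_index_colours sG2 sG1 (@subset_refl _ G1) tc.
  by rewrite (setIidr G21) => /(has_index_subgroup_index sG2) ->.
split.
- apply: (mulIf m_neq0); rewrite divfK // -natrM S1n S2q.
  by congr _%:R; rewrite mulnC -(idx _ _ iLm) (idx _ _ iLtu) mulnC.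
- apply: (mulIf m_neq0); rewrite divfK // -natrM S1n S2q.
  by congr _%:R; rewrite mulnC -(idx _ _ iLm) (idx _ _ iLsv) mulnC.
have dvd A B := @colours_dvd _ _ c G1 G2 A B sG2.
(* The inclusions used are, in order, [K'] in [G1], [csl G1 Q] in [G1], [M] in [K'], and [K2] in
   [csl G1 Q]. *)
split.
- by rewrite -[X in (_ %| X)%N]colm; apply: dvd.
- by rewrite -[X in (_ %| X)%N]colm; apply: dvd.
- by rewrite uE; apply: dvd.
- by rewrite vE; apply: dvd.
Qed.
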